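(* Let $P=(A^\exists, A^\forall, \mathbf{b}^\exists, \mathbf{b}^\forall, \mathbf{c}, \mathcal{L}, \mathbf{Q})$ be a quantified integer program (QIP) with polyhedral uncertainty, let $\hat{\mathbf{x}}_\forall \in \mathcal{L}_\forall$ be a scenario, and let $R$ be the LP-relaxation of $P$ with fixed scenario $\hat{\mathbf{x}}_\forall$, i.e. the linear program $$\min\left\lbrace \mathbf{c}\mathbf{x} \;\middle|\; \mathbf{x}\in \mathcal{L}_{relax},\ \mathbf{x}_\forall = \hat{\mathbf{x}}_\forall,\ A^\exists \mathbf{x}\leq \mathbf{b}^\exists \right\rbrace .$$ Then the following holds: (a) If $R$ is infeasible, then $P$ is infeasible. (b) If $R$ is feasible with optimal value $z_R$, then either $P$ is infeasible, or $P$ is feasible with optimal value $z_P \geq z_R$.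
   Context: Vectors are in bold and $\mathbf{c}\mathbf{x}$ denotes the scalar product. **Data of a QIP with polyhedral uncertainty.** There are $n$ ordered variables $x_1,\dots,x_n$. Each $x_j$ has a bounded domain $\mathcal{L}_j=\{y\in\mathbb{Z}\mid l_j\le y\le u_j\}\neq\emptyset$ with finite rational bounds $l_j,u_j$, and $\mathcal{L}=\{\mathbf{y}\in\mathbb{Z}^n\mid y_j\in\mathcal{L}_j \text{ for all } j\in\{1,\dots,n\}\}$. The set $\mathcal{L}_{relax}=\{\mathbf{y}\in\mathbb{R}^n\mid l_j\le y_j\le u_j \text{ for all } j\}$ is $\mathcal{L}$ without the integrality condition. $\mathbf{Q}\in\{\exists,\forall\}^n$ is the vector of quantifiers; a variable $x_j$ is existential if $Q_j=\exists$ and universal if $Q_j=\forall$. Each maximal consecutive subsequence of identical quantifiers is a block; $\beta$ is the number of blocks, $Q^{(i)}$ is the quantifier of block $i$, and $\mathbf{x}^{(i)}$, $\mathbf{c}^{(i)}$, $\mathcal{L}^{(i)}$ are the parts of $\mathbf{x}$, $\mathbf{c}$, $\mathcal{L}$ belonging to block $i$. It is assumed that $Q^{(1)}=Q^{(\beta)}=\exists$. $\mathbf{c}\in\mathbb{Q}^n$; $A^\exists\mathbf{x}\le\mathbf{b}^\exists$ (existential constraint system) and $A^\forall\mathbf{x}\le\mathbf{b}^\forall$ (universal constraint system) are finite systems of linear inequalities with rational data. The columns of $A^\forall$ belonging to existential variables are zero, so the universal system restricts only universal variables. For $\mathbf{x}\in\mathbb{R}^n$, $\mathbf{x}_\exists$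 and $\mathbf{x}_\forall$ denote the subvectors of existential and universal variables. **Uncertainty set and legal plays.** Let $\mathcal{D}=\{\mathbf{x}\in\mathcal{L}\mid A^\forall\mathbf{x}\le\mathbf{b}^\forall\}$. The uncertainty set is $\mathcal{L}_\forall=\{\mathbf{x}_\forall\mid\mathbf{x}\in\mathcal{D}\}$, assumed nonempty; its elements are called scenarios. For given $\tilde{\mathbf{x}}^{(1)},\dots,\tilde{\mathbf{x}}^{(i-1)}$, the domain of block $i$ is $$\mathcal{D}^{(i)}(\tilde{\mathbf{x}}^{(1)},\dots,\tilde{\mathbf{x}}^{(i-1)})=\begin{cases}\mathcal{L}^{(i)} & \text{if } Q^{(i)}=\exists,\\ \{\mathbf{y}\in\mathcal{L}^{(i)}\mid \exists\,\mathbf{x}=(\tilde{\mathbf{x}}^{(1)},\dots,\tilde{\mathbf{x}}^{(i-1)},\mathbf{y},\mathbf{x}^{(i+1)},\dots,\mathbf{x}^{(\beta)})\in\mathcal{D}\} & \text{if } Q^{(i)}=\forall.\end{cases}$$ **The problem.** The QIP with polyhedral uncertainty $P$ is $$\min_{\mathbf{x}^{(1)}\in\mathcal{D}^{(1)}}\Big(\mathbf{c}^{(1)}\mathbf{x}^{(1)}+\max_{\mathbf{x}^{(2)}\in\mathcal{D}^{(2)}}\Big(\mathbf{c}^{(2)}\mathbf{x}^{(2)}+\min_{\mathbf{x}^{(3)}\in\mathcal{D}^{(3)}}\big(\mathbf{c}^{(3)}\mathbf{x}^{(3)}+\dots+\min_{\mathbf{x}^{(\beta)}\in\mathcal{D}^{(\beta)}}\mathbf{c}^{(\beta)}\mathbf{x}^{(\beta)}\big)\Big)\Big)$$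 subject to $Q^{(1)}\mathbf{x}^{(1)}\in\mathcal{D}^{(1)}\ Q^{(2)}\mathbf{x}^{(2)}\in\mathcal{D}^{(2)}(\mathbf{x}^{(1)})\ \cdots\ Q^{(\beta)}\mathbf{x}^{(\beta)}\in\mathcal{D}^{(\beta)}(\mathbf{x}^{(1)},\dots,\mathbf{x}^{(\beta-1)}):\ A^\exists\mathbf{x}\le\mathbf{b}^\exists$. It is interpreted as a zero-sum game: blocks are set in order with full knowledge of the earlier blocks, existential blocks by a minimizing player and universal blocks by a maximizing player; the payoff of a complete play $\mathbf{x}$ is $\mathbf{c}\mathbf{x}$ if $A^\exists\mathbf{x}\le\mathbf{b}^\exists$ and $+\infty$ otherwise. A (winning) strategy for the existential player prescribes the assignment of each existential block as a function of the preceding blocks such that every resulting play against legal universal moves satisfies $A^\exists\mathbf{x}\le\mathbf{b}^\exists$. $P$ is feasible if a winning strategy exists and infeasible otherwise; the value of a winning strategy is the maximum of $\mathbf{c}\mathbf{x}$ over its plays, and the optimal value of a feasible $P$ is the minimum value over all winning strategies (equivalently the min-max value of the game). *)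

(* Defs.v *)
(* The real numbers are an arbitrary realType R; problem data are rational and
   embedded by ratr, integer vectors by intr. *)
From HB Require Import structures.
From mathcomp Require Import all_boot all_order all_algebra.
From mathcomp Require Import classical_sets reals.

Set Implicit Arguments.
Unset Strict Implicit.
Unset Printing Implicit Defensive.

Import Order.TTheory GRing.Theory Num.Theory.
Local Open Scope classical_set_scope.
Local Open Scope ring_scope.

Variant quantifier := Qexists | Qforall.

Definition bool_of_quantifier (q : quantifier) : bool :=
  if q is Qforall then true else false.
Definition quantifier_of_bool (b : bool) : quantifier :=
  if b then Qforall else Qexists.

Lemma bool_of_quantifierK : cancel bool_of_quantifier quantifier_of_bool.
Proof. by case. Qed.

HB.instance Definition _ :=
  Equality.copy quantifier (can_type bool_of_quantifierK).

(* Variables are indexed by 'I_n in the order of play. *)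
Record qip (n : nat) := Qip {
  nrowsE : nat;
  nrowsU : nat;
  AE : 'M[rat]_(nrowsE, n);
  AU : 'M[rat]_(nrowsU, n);
  bE : 'cV[rat]_nrowsE;
  bU : 'cV[rat]_nrowsU;
  cost : 'cV[rat]_n;
  lower : 'cV[rat]_n;
  upper : 'cV[rat]_n;
  quant : 'I_n -> quantifier
}.

Definition dotp (R : realType) (n : nat) (c x : 'cV[R]_n) : R :=
  \sum_j c j 0 * x j 0.

Definition satisfies (R : realType) (m n : nat)
    (A : 'M[rat]_(m, n)) (b : 'cV[rat]_m) (x : 'cV[R]_n) : Prop :=
  forall i, (map_mx ratr A *m x) i 0 <= ratr (b i 0).

Definition real_vec (R : realType) (n : nat) (x : 'cV[int]_n) : 'cV[R]_n :=
  map_mx intr x.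

Definition objective (R : realType) (n : nat) (P : qip n) (x : 'cV[R]_n) : R :=
  dotp (map_mx ratr (cost P)) x.

Definition relaxed_domain (R : realType) (n : nat) (P : qip n) : set 'cV[R]_n :=
  [set y : 'cV[R]_n | forall j, ratr (lower P j 0) <= y j 0 <= ratr (upper P j 0)].

Definition var_domain (n : nat) (P : qip n) (j : 'I_n) : set int :=
  [set y : int | (lower P j 0 <= y%:~R <= upper P j 0)%R].

Definition domain (n : nat) (P : qip n) : set 'cV[int]_n :=
  [set y : 'cV[int]_n | forall j, var_domain P j (y j 0)].

Definition legal_domain (R : realType) (n : nat) (P : qip n) :
    set 'cV[int]_n :=
  [set x : 'cV[int]_n | domain P x /\ satisfies (AU P) (bU P) (real_vec R x)].

Notation universal_index P := {j | quant P j == Qforall}.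

Definition universal_part (n : nat) (P : qip n) (T : Type) (x : 'cV[T]_n) :
    {ffun universal_index P -> T} :=
  [ffun j => x (val j) 0].

Definition uncertainty_set (R : realType) (n : nat) (P : qip n) :
    set {ffun universal_index P -> int} :=
  [set universal_part P x | x in legal_domain R P].
Arguments uncertainty_set R {n} P _.

Definition starts_block (n : nat) (P : qip n) (j : 'I_n) : bool :=
  [forall i : 'I_n, (i.+1 == j :> nat) ==> (quant P i != quant P j)].

(* Blocks are numbered from 1 to nblocks P. *)
Definition block_of (n : nat) (P : qip n) (j : 'I_n) : nat :=
  #|[pred k : 'I_n | (k <= j)%N && starts_block P k]|.

Definition nblocks (n : nat) (P : qip n) : nat :=
  #|[pred k : 'I_n | starts_block P k]|.

(* By block_quant_of below, any variable of the block determines the value.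
   Numbers outside 1 .. nblocks P contain no variable; they get Qexists, and
   every condition below quantified over all i is void for them. *)
Definition block_quant (n : nat) (P : qip n) (i : nat) : quantifier :=
  if [exists j : 'I_n, (block_of P j == i) && (quant P j == Qforall)]
  then Qforall else Qexists.

Definition agree_before (n : nat) (P : qip n) (i : nat) (x y : 'cV[int]_n) :
    Prop :=
  forall j, (block_of P j < i)%N -> x j 0 = y j 0.

Definition agree_on_block (n : nat) (P : qip n) (i : nat) (x y : 'cV[int]_n) :
    Prop :=
  forall j, block_of P j = i -> x j 0 = y j 0.

(* The vectors y whose block-i part lies in the domain of block i, given the
   blocks of x before block i; the other entries of x and y are ignored. *)
Definition block_domain (R : realType) (n : nat) (P : qip n) (i : nat)
    (x : 'cV[int]_n) : set 'cV[int]_n :=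
  [set y : 'cV[int]_n | (forall j, block_of P j = i -> var_domain P j (y j 0)) /\
    (block_quant P i = Qforall ->
     exists z, [/\ legal_domain R P z, agree_before P i z x
                 & agree_on_block P i z y])].

(* For an existential block i, the assignment prescribed after the history x
   is the block-i part of s i x; it depends only on the blocks of x before i. *)
Definition is_strategy (R : realType) (n : nat) (P : qip n)
    (s : nat -> 'cV[int]_n -> 'cV[int]_n) : Prop :=
  forall i, block_quant P i = Qexists ->
    (forall x, block_domain R P i x (s i x)) /\
    (forall x y, agree_before P i x y -> agree_on_block P i (s i x) (s i y)).

Definition plays (R : realType) (n : nat) (P : qip n)
    (s : nat -> 'cV[int]_n -> 'cV[int]_n) : set 'cV[int]_n :=
  [set x : 'cV[int]_n | forall i,
    (block_quant P i = Qexists -> agree_on_block P i x (s i x)) /\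
    (block_quant P i = Qforall -> block_domain R P i x x)].

Definition winning_strategy (R : realType) (n : nat) (P : qip n)
    (s : nat -> 'cV[int]_n -> 'cV[int]_n) : Prop :=
  is_strategy R P s /\
  forall x, plays R P s x -> satisfies (AE P) (bE P) (real_vec R x).

Definition qip_feasible (R : realType) (n : nat) (P : qip n) : Prop :=
  exists s, winning_strategy R P s.

Definition is_max (R : realType) (S : set R) (z : R) : Prop :=
  S z /\ ubound S z.

Definition is_min (R : realType) (S : set R) (z : R) : Prop :=
  S z /\ lbound S z.

Definition strategy_value (R : realType) (n : nat) (P : qip n)
    (s : nat -> 'cV[int]_n -> 'cV[int]_n) (v : R) : Prop :=
  is_max [set objective P (real_vec R x) | x in plays R P s] v.

Definition qip_optimal_value (R : realType) (n : nat) (P : qip n) (z : R) :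
    Prop :=
  is_min [set v : R | exists2 s, winning_strategy R P s & strategy_value P s v] z.

Record qip_assumptions (R : realType) (n : nat) (P : qip n) : Prop := {
  var_domain_nonempty : forall j, var_domain P j !=set0;
  has_variables : (0 < n)%N;
  first_block_exists : block_quant P 1 = Qexists;
  last_block_exists : block_quant P (nblocks P) = Qexists;
  AU_existential_columns :
    forall i j, quant P j = Qexists -> AU P i j = 0;
  uncertainty_set_nonempty : uncertainty_set R P !=set0
}.

Definition lp_solutions (R : realType) (n : nat) (P : qip n)
    (xhat : {ffun universal_index P -> int}) : set 'cV[R]_n :=
  [set x : 'cV[R]_n | [/\ relaxed_domain P x,
               universal_part P x = [ffun j => (xhat j)%:~R]
             & satisfies (AE P) (bE P) x]].
Arguments lp_solutions R {n} P xhat _.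

Definition lp_feasible (R : realType) (n : nat) (P : qip n)
    (xhat : {ffun universal_index P -> int}) : Prop :=
  lp_solutions R P xhat !=set0.
Arguments lp_feasible R {n} P xhat.

Definition lp_optimal_value (R : realType) (n : nat) (P : qip n)
    (xhat : {ffun universal_index P -> int}) (z : R) : Prop :=
  is_min [set objective P x | x in lp_solutions R P xhat] z.
Arguments lp_optimal_value {R n} P xhat z.

Lemma block_of_eq_quant (n : nat) (P : qip n) (j k : 'I_n) :
  block_of P j = block_of P k -> quant P j = quant P k.
Proof.
wlog le_jk : j k / (j <= k)%N.
  by move=> H e; case/orP: (leq_total j k) => h; [|symmetry]; apply: H.
move=> e.
have sub : [pred l : 'I_n | (l <= j)%N && starts_block P l]
   \subset [pred l : 'I_n | (l <= k)%N && starts_block P l].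
  apply/fintype.subsetP => l; rewrite !inE => /andP[lj ->]; rewrite andbT.
  exact: leq_trans lj le_jk.
have E := subset_cardP e sub.
have nst (l : 'I_n) : (j < l <= k)%N -> ~~ starts_block P l.
  case/andP=> jl lk; apply/negP => st.
  have := E l; rewrite !inE lk st leqNgt jl; discriminate.
suff H m (l : 'I_n) : (l = j + m :> nat)%N -> (l <= k)%N ->
    quant P j = quant P l.
  by apply: (H (k - j)%N k) => //; rewrite subnKC.
elim: m l => [|m IH] l hl lk.
  by congr (quant P _); apply: val_inj; rewrite /= hl addn0.
have: ~~ starts_block P l by apply: nst; rewrite lk hl addnS ltnS leq_addr.
rewrite negb_forall => /existsP[i]; rewrite negb_imply negbK.
case/andP=> /eqP il /eqP <-; apply: IH.
  by apply/eqP; rewrite -eqSS il hl addnS.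
by apply: leq_trans lk; rewrite -il leqnSn.
Qed.

Lemma block_quant_of (n : nat) (P : qip n) (j : 'I_n) :
  block_quant P (block_of P j) = quant P j.
Proof.
rewrite /block_quant; case: ifP => [/existsP[k /andP[/eqP e /eqP <-]]|/negbT].
  exact: block_of_eq_quant.
rewrite negb_exists => /forallP /(_ j); rewrite eqxx /=.
by case: (quant P j).
Qed.

(* Main.v *)
(* Replaying a winning strategy against the fixed scenario gives a play whose
   universal part is that scenario; this play satisfies the existential system,
   hence is a solution of the linear program. Its cost is at least z_R and at
   most the value of the strategy. The optimal value exists because costs of
   plays take finitely many values, all bounds being finite. *)
Require Import Defs.
From mathcomp Require Import all_boot all_order all_algebra.
From mathcomp Require Import classical_sets reals.
From mathcomp Require Import boolp.
From mathcomp Require Import zify.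
Import Order.TTheory GRing.Theory Num.Theory.
Local Open Scope ring_scope.

Set Implicit Arguments.
Unset Strict Implicit.
Unset Printing Implicit Defensive.

Section FiniteExtrema.
Variables (R : realType) (T : finType) (F : T -> R) (S : set R).
Hypotheses (S_nonempty : (S !=set0)%classic)
  (S_finite : (S `<=` [set F t | t in [set: T]])%classic).

(** [S] may be a proper part of the image of [F], so the minimum is taken over the indices [t] with
    [F t] in [S] only. *)
Lemma is_min_finite : exists z, is_min S z.
Proof.
case: S_nonempty => v Sv; have [t0 _ Ft0] := S_finite Sv.
have St0 : `[< S (F t0) >] by apply/asboolP; rewrite Ft0.
case: (@arg_minP _ _ _ t0 (fun t => `[< S (F t) >]) F St0) => t /asboolP St tmin.
exists (F t); split=> // u Su; have [t' _ Ft'] := S_finite Su.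
by rewrite -Ft'; apply: tmin; apply/asboolP; rewrite Ft'.
Qed.

Lemma is_max_finite : exists z, is_max S z.
Proof.
case: S_nonempty => v Sv; have [t0 _ Ft0] := S_finite Sv.
have St0 : `[< S (F t0) >] by apply/asboolP; rewrite Ft0.
case: (@arg_maxP _ _ _ t0 (fun t => `[< S (F t) >]) F St0) => t /asboolP St tmax.
exists (F t); split=> // u Su; have [t' _ Ft'] := S_finite Su.
by rewrite -Ft'; apply: tmax; apply/asboolP; rewrite Ft'.
Qed.

End FiniteExtrema.

Lemma domain_bounded (n : nat) (P : qip n) :
  exists B : nat, forall x, domain P x -> forall j, (`|x j ord0| <= B)%N.
Proof.
(* Any number between the two bounds has absolute value at most the sum of their absolute values;
   [Num.bound] gives a natural number above this rational sum. *)
pose b j := Num.bound (`|lower P j ord0| + `|upper P j ord0|).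
exists (\max_j b j) => x xP j.
apply: leq_trans (leq_bigmax j); apply: ltnW.
have hb : `|lower P j ord0| + `|upper P j ord0| < (b j)%:R.
  by apply: archi_boundP; rewrite addr_ge0.
rewrite -(ltr_nat rat) natr_absz intr_norm; apply: le_lt_trans hb.
have /andP[lx xu] := xP j; rewrite ler_norml; apply/andP; split.
  apply: le_trans lx; rewrite opprD -[leRHS]addr0 lerD ?oppr_le0//.
  by rewrite lerNl ler_normr lexx orbT.
by apply: le_trans xu _; rewrite (le_trans (ler_norm _))// lerDr.
Qed.

(** With all entries in [[-B, B]], shifting by [B] encodes a vector by digits in [0 .. 2B]. Only
    surjectivity onto the domain is claimed: [f t] may violate the bounds. *)
Lemma domain_finite (n : nat) (P : qip n) :
  exists (T : finType) (f : T -> 'cV[int]_n),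
    forall x, domain P x -> exists t, f t = x.
Proof.
have [B hB] := domain_bounded P.
exists {ffun 'I_n -> 'I_(B + B).+1}.
exists (fun t : {ffun 'I_n -> 'I_(B + B).+1} => \col_j ((t j : nat)%:Z - B%:Z)) => x /hB xB.
exists [ffun j => inord (absz (x j ord0 + B%:Z))].
apply/colP => j; rewrite !mxE ffunE; move: (x j ord0) (xB j) => y yB.
by rewrite inordK; lia.
Qed.

Section Plays.
Variables (R : realType) (n : nat) (P : qip n).
Variable s : nat -> 'cV[int]_n -> 'cV[int]_n.
Hypothesis s_strategy : is_strategy R P s.

Lemma plays_domain (x : 'cV[int]_n) : plays R P s x -> domain P x.
Proof.
move=> xs j; have [xE xU] := xs (block_of P j).
case qj: (block_quant P (block_of P j)).
  rewrite (xE qj j erefl); have [sdom _] := s_strategy qj.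
  by have [+ _] := sdom x; apply.
by have [+ _] := xU qj; apply.
Qed.

(* Existential blocks below [i] come from [s], everything else from [w]. *)
Fixpoint replay (w : 'cV[int]_n) (i : nat) : 'cV[int]_n :=
  if i is k.+1 then
    \col_j (if (block_of P j == k) && (quant P j == Qexists)
            then s k (replay w k) j ord0 else replay w k j ord0)
  else w.

Lemma replay_universal w i j :
  quant P j = Qforall -> replay w i j ord0 = w j ord0.
Proof. by move=> qj; elim: i => //= i IH; rewrite mxE qj andbF. Qed.

(** Stage [k.+1] changes entries of block [k] only, so blocks below [i] are final from stage [i]
    on. *)
Lemma replay_stable w i k j : (block_of P j < i)%N -> (i <= k)%N ->
  replay w k j ord0 = replay w i j ord0.
Proof.
move=> ji; elim: k => [|k IH]; first by rewrite leqn0 => /eqP ->.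
rewrite leq_eqVlt => /predU1P[->//|ik]; rewrite /= mxE.
by rewrite [_ == k](ltn_eqF (leq_trans ji ik)) /= IH.
Qed.

Lemma block_of_le j : (block_of P j <= n)%N.
Proof. by rewrite -[leqRHS]card_ord max_card. Qed.

(** Block numbers are at most [n] and block [k] is filled at stage [k.+1], so [n.+1] stages reach
    every block. *)
Definition scenario_play w := replay w n.+1.

(** Block [i] was computed from the unfinished vector [replay w i]. The strategy answers the
    finished play in the same way, since both agree before block [i] and strategies are
    nonanticipative. *)
Lemma scenario_play_existential w i : block_quant P i = Qexists ->
  agree_on_block P i (scenario_play w) (s i (scenario_play w)).
Proof.
move=> qi j ji; have iN : (i <= n)%N by rewrite -ji block_of_le.
have qj : quant P j = Qexists by rewrite -block_quant_of ji.
have [_ /(_ (replay w i) (scenario_play w))] := s_strategy qi.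
move=> /(_ _ j ji) <-; last first.
  by move=> k ki; rewrite (@replay_stable w i n.+1)// ltnW.
rewrite /scenario_play (@replay_stable w i.+1) ?ji//.
by rewrite /= mxE ji qj !eqxx.
Qed.

Lemma satisfies_AU_universal (x w : 'cV[int]_n) :
  (forall i j, quant P j = Qexists -> AU P i j = 0) ->
  (forall j, quant P j = Qforall -> x j ord0 = w j ord0) ->
  satisfies (AU P) (bU P) (real_vec R w) ->
  satisfies (AU P) (bU P) (real_vec R x).
Proof.
move=> AU0 xw hw i; have := hw i; rewrite !mxE; congr (_ <= _).
apply: eq_bigr => j _; rewrite !mxE; case qj: (quant P j).
  by rewrite AU0// raddf0 !mul0r.
by rewrite xw.
Qed.

Lemma scenario_play_legal w : qip_assumptions R P ->
  legal_domain R P w -> legal_domain R P (scenario_play w).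
Proof.
move=> hP [wdom wAU]; split; last first.
  apply: satisfies_AU_universal wAU; first exact: AU_existential_columns hP.
  by move=> j; exact: replay_universal.
move=> j; case qj: (quant P j); last by rewrite replay_universal.
have qb : block_quant P (block_of P j) = Qexists by rewrite block_quant_of.
rewrite (scenario_play_existential w qb erefl).
by have [/(_ (scenario_play w))[+ _] _] := s_strategy qb; apply.
Qed.

Lemma scenario_play_plays w : qip_assumptions R P ->
  legal_domain R P w -> plays R P s (scenario_play w).
Proof.
move=> hP hw i; split; first exact: scenario_play_existential.
have xlegal := scenario_play_legal hP hw.
(* The whole play is legal, so it is its own completion witnessing each universal move. *)
by split=> [j _|_]; [exact: xlegal.1 | exists (scenario_play w)].
Qed.

End Plays.

Lemma real_vec_relaxed (R : realType) (n : nat) (P : qip n) x :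
  domain P x -> relaxed_domain P (real_vec R x).
Proof. by move=> xP j; rewrite mxE -ratr_int !ler_rat; exact: xP. Qed.

Section WinningStrategy.
Variables (R : realType) (n : nat) (P : qip n).
Variable s : nat -> 'cV[int]_n -> 'cV[int]_n.
Hypotheses (hP : qip_assumptions R P) (s_winning : winning_strategy R P s).

(** The scenario is extended to a legal vector [w], whose existential entries are then overwritten
    by the replies of [s]. This one play serves both claims of the theorem. *)
Lemma winning_lp_solution xhat : uncertainty_set R P xhat ->
  exists2 x, plays R P s x & lp_solutions R P xhat (real_vec R x).
Proof.
case: s_winning => s_strategy s_sat [w hw <-].
have xs := scenario_play_plays s_strategy hP hw.
exists (scenario_play P s w) => //; split; last exact: s_sat.
  exact/real_vec_relaxed/(plays_domain s_strategy).
apply/ffunP => j; rewrite !ffunE mxE /scenario_play replay_universal//.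
exact/eqP/(valP j).
Qed.

Lemma strategy_value_exists : exists v : R, strategy_value P s v.
Proof.
have [T [f f_onto]] := domain_finite P.
apply: (@is_max_finite _ _ (fun t => objective P (real_vec R (f t)))).
  have [xhat hx] := uncertainty_set_nonempty hP.
  have [x xs _] := winning_lp_solution hx.
  by exists (objective P (real_vec R x)); exists x.
move=> _ [x xs <-]; have [t <-] := f_onto x (plays_domain s_winning.1 xs).
by exists t.
Qed.

End WinningStrategy.

(** Strategies are functions on all integer vectors, but each value is attained at a play and hence
    is the cost of a point of the finite domain. *)
Lemma qip_optimal_value_exists (R : realType) (n : nat) (P : qip n) :
  qip_assumptions R P -> qip_feasible R P ->
  exists z : R, qip_optimal_value P z.
Proof.
move=> hP [s s_winning]; have [T [f f_onto]] := domain_finite P.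
apply: (@is_min_finite _ _ (fun t => objective P (real_vec R (f t)))).
  have [v sv] := strategy_value_exists hP s_winning.
  by exists v; exists s.
move=> v [s' s'_winning [[x xs <-] _]].
by have [t <-] := f_onto x (plays_domain s'_winning.1 xs); exists t.
Qed.

Theorem proposition3 (R : realType) (n : nat) (P : qip n)
    (xhat : {ffun universal_index P -> int})
    (hP : qip_assumptions R P)
    (hxhat : uncertainty_set R P xhat) :
  (~ lp_feasible R P xhat -> ~ qip_feasible R P) /\
  (forall zR : R, lp_feasible R P xhat -> lp_optimal_value P xhat zR ->
     ~ qip_feasible R P \/
     (qip_feasible R P /\
      exists zP : R, qip_optimal_value P zP /\ zR <= zP)).
Proof.
split=> [lp_infeasible [s s_winning]|zR _ [_ zR_lb]].
  have [x _ x_lp] := winning_lp_solution hP s_winning hxhat.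
  by apply: lp_infeasible; exists (real_vec R x).
case: (pselect (qip_feasible R P)) => [feas|]; [right; split=> // | by left].
have [zP zP_opt] := qip_optimal_value_exists hP feas.
(* The optimal value is attained: [s] is a winning strategy of value [zP], so [zP] bounds the cost
   of all its plays. *)
exists zP; split=> //; have [[s s_winning [_ zP_ub]] _] := zP_opt.
have [x xs x_lp] := winning_lp_solution hP s_winning hxhat.
apply: (@le_trans _ _ (objective P (real_vec R x))).
  by apply: zR_lb; exists (real_vec R x).
by apply: zP_ub; exists x.
Qed.
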